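(* For every integer $n>1$ there exists a natural number $k_n$ such that if $\Gamma=\mathrm{Cay}(\mathbb{Z}^n;S)$ is a non-empty, locally finite Cayley (di)graph on $\mathbb{Z}^n$ (i.e. $S$ is finite and non-empty) with at least $k_n$ (possibly infinitely many) connected components, then $\Gamma$ is not a (D)CI-graph.
   Context: For a group $G$ and a subset $S\subseteq G\setminus\{e\}$, the Cayley digraph $\mathrm{Cay}(G;S)$ has vertex set $G$ and an arc from $g$ to $gs$ for all $g\in G$, $s\in S$; if $S=S^{-1}$ it is regarded as an undirected Cayley graph. The digraph $\mathrm{Cay}(G;S)$ is a DCI-graph if whenever $S'\subseteq G\setminus\{e\}$ and $\mathrm{Cay}(G;S)\cong\mathrm{Cay}(G;S')$ as digraphs, there is a group automorphism $\alpha$ of $G$ with $\alpha(S)=S'$. An undirected Cayley graph (so $S=S^{-1}$) is a CI-graph if the same holds for all $S'=S'^{-1}$. Connected components of a digraph are those of its underlying undirected graph. The notation ''(D)CI'' means that the statement holds both for undirected graphs with ''CI'' and for digraphs with ''DCI''. *)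

(* Defs.v *)
From HB Require Import structures.
From Stdlib Require Import Relation_Operators.
From mathcomp Require Import all_boot all_order all_algebra.
From mathcomp Require Import boolp classical_sets functions cardinality.

Set Implicit Arguments.
Unset Strict Implicit.
Unset Printing Implicit Defensive.

Import GRing.Theory.

Local Open Scope classical_set_scope.
Local Open Scope ring_scope.

(* A digraph on a vertex type V is its arc relation V -> V -> Prop; an
   undirected graph is one whose arc relation is symmetric, so isomorphism of
   undirected graphs is the same notion. *)

Definition digraph_iso (V W : Type) (E : V -> V -> Prop) (F : W -> W -> Prop)
    : Prop :=
  exists2 f : V -> W, bijective f & forall x y, E x y <-> F (f x) (f y).

(* clos_refl_sym_trans E is connectedness in the underlying undirected graph. *)
Definition components (V : Type) (E : V -> V -> Prop) : set (set V) :=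
  range (fun x => [set y | clos_refl_sym_trans V E x y]).

Section Cayley.
Variable G : zmodType.
Implicit Types S : set G.

(* Groups are written additively: e is 0, gs is g + s, S^-1 is -%R @` S. *)
Definition connection_set S : Prop := ~ S 0.

Definition inverse_closed S : Prop := -%R @` S = S.

Definition Cay S (g h : G) : Prop := exists2 s, S s & h = g + s.

Definition aut_equivalent S S' : Prop :=
  exists2 alpha : {additive G -> G}, bijective alpha & alpha @` S = S'.

Definition DCI_graph S : Prop :=
  forall S', connection_set S' ->
    digraph_iso (Cay S) (Cay S') -> aut_equivalent S S'.

(* Only meaningful for inverse-closed S, where Cay S is undirected. *)
Definition CI_graph S : Prop :=
  forall S', connection_set S' -> inverse_closed S' ->
    digraph_iso (Cay S) (Cay S') -> aut_equivalent S S'.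

End Cayley.

(* Main.v *)
Require Import Defs.
From mathcomp Require Import all_boot all_order all_algebra.
From mathcomp Require Import boolp classical_sets functions cardinality.
From Stdlib Require Import Relation_Operators.
From mathcomp Require Import zify ring.

(** Let H be the subgroup generated by S; the components of Cay S are its
    cosets.  By the Smith normal form, S is the set of rows of L *m M, where the
    rows of L generate Z^n and M is a square matrix, diagonal up to a change of
    basis; thus H is the row space of M.

    If f is a bijection of Z^n carrying every translation by t *m M to the
    translation by t *m M', then f is an isomorphism from Cay of the rows of
    L *m M to Cay of the rows of L *m M'.  Such an f exists whenever the two row
    spaces have equally many cosets and the two matrices have the same left
    kernel.  The cases that matter all come from [scale_at_move]: multiplying
    one coordinate by b may be traded for multiplying another one by b, through
    the division-with-carry bijection of Z^2.

    If H has infinite index, some diagonal entry of M vanishes.  Factors gathered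
    at that entry are swallowed by the zero, so M and 2M are equivalent, and
    Cay S is isomorphic to Cay (2S).  No automorphism sends S to 2S: every
    element of S would be divisible by every power of 2
    ([not_aut_equivalent_double]).

    If H has finite index m, then M is equivalent to each of the m matrices B_j
    ([shear_scale]), which agree with diag(m, 1, ..., 1) but for an entry j < m
    next to m.  Suppose that all of them give connection sets equivalent to S by
    automorphisms A_j.  Then M *m A_j = b_j *m B_j with b_j an integral
    invertible matrix that permutes the rows of L ([integral_transfer]).  No B_j
    becomes another B_k by an automorphism acting on the right
    ([shear_scale_index_inj]), so the b_j are pairwise distinct.  But they lie
    in a finite subgroup of GL_n(Z), and such a group embeds into GL_n(Z/3) by
    Minkowski's lemma ([congruent1_permuting_eq1]).  So m <= 3 ^ (n * n), a
    bound that depends on n only. *)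

Set Implicit Arguments.
Unset Strict Implicit.
Unset Printing Implicit Defensive.

Import Order.TTheory GRing.Theory Num.Theory.

Local Open Scope classical_set_scope.
Local Open Scope card_scope.
Local Open Scope ring_scope.

(** * Matrices defining equivalent actions by translations *)

Definition row_set N n (L : 'M[int]_(N, n)) : set 'rV[int]_n :=
  range (fun i => row i L).

(** A matrix M makes Z^n act on Z^n, with t acting as the translation by
    t *m M; the relation is isomorphism of these Z^n-sets. *)
Definition equiv_translations n (M M' : 'M[int]_n) : Prop :=
  exists2 f : 'rV[int]_n -> 'rV[int]_n,
    bijective f & forall x t : 'rV[int]_n, f (x + t *m M) = f x + t *m M'.

Section EquivTranslations.
Variable n : nat.
Implicit Types M P R : 'M[int]_n.

Lemma equiv_translations_sym M M' :
  equiv_translations M M' -> equiv_translations M' M.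
Proof.
case=> f [g fK gK] fE; exists g; first by exists f.
by move=> x t; rewrite -{1}[x]gK -fE fK.
Qed.

Lemma equiv_translations_trans M1 M2 M3 :
  equiv_translations M1 M2 -> equiv_translations M2 M3 ->
  equiv_translations M1 M3.
Proof.
case=> f bf fE [g bg gE]; exists (g \o f); first exact: bij_comp.
by move=> x t /=; rewrite fE gE.
Qed.

Lemma equiv_translations_mull P M M' :
  equiv_translations M M' -> equiv_translations (P *m M) (P *m M').
Proof. by case=> f bf fE; exists f => // x t; rewrite !mulmxA fE. Qed.

(** A change of basis of the ambient Z^n is itself an isomorphism of the
    actions. *)
Lemma equiv_translations_mulr M R :
  R \in unitmx -> equiv_translations M (M *m R).
Proof.
move=> uR; exists (mulmx^~ R); last by move=> x t; rewrite mulmxDl mulmxA.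
by exists (mulmx^~ (invmx R)) => x; rewrite ?mulmxK ?mulmxKV.
Qed.

(** Isomorphic actions have the same kernel, so relations between the
    translations, such as t acting trivially or as the inverse of u, carry over
    from M to M'. *)
Lemma equiv_translations_eq M M' (t u : 'rV_n) :
  equiv_translations M M' -> (t *m M = u *m M) <-> (t *m M' = u *m M').
Proof.
case=> f [g fK gK] fE; split=> [E|E].
  by apply: (@addrI _ (f 0)); rewrite -!fE E.
apply: (@addrI _ (0 : 'rV_n)); apply: (can_inj fK).
by rewrite (fE 0 t) (fE 0 u) E.
Qed.

Lemma Cay_equiv_translations N (L : 'M_(N, n)) M M' :
  equiv_translations M M' ->
  digraph_iso (Cay (row_set (L *m M))) (Cay (row_set (L *m M'))).
Proof.
case=> f bf fE; exists f => // x y; split=> -[_ [i _ <-]].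
  by move=> ->; exists (row i (L *m M')); [exists i|rewrite !row_mul fE].
move=> E; exists (row i (L *m M)); first by exists i.
apply: (bij_inj bf).
by rewrite E !row_mul fE.
Qed.

Lemma connection_set_equiv N (L : 'M_(N, n)) M M' :
  equiv_translations M M' ->
  connection_set (row_set (L *m M)) -> connection_set (row_set (L *m M')).
Proof.
move=> eqM S0 [i _ Ei]; apply: S0; exists i => //; move: Ei.
rewrite !row_mul.
by have := equiv_translations_eq (row i L) 0 eqM; rewrite !mul0mx => -[_].
Qed.

Lemma inverse_closedP (S : set 'rV[int]_n) :
  inverse_closed S <-> (forall x, S x -> S (- x)).
Proof.
split=> [SE x Sx|SN]; first by rewrite -SE; exists x.
apply/seteqP; split=> [_ [x Sx <-]|x Sx]; first exact: SN.
by exists (- x); [exact: SN|exact: opprK].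
Qed.

Lemma inverse_closed_equiv N (L : 'M_(N, n)) M M' :
  equiv_translations M M' ->
  inverse_closed (row_set (L *m M)) -> inverse_closed (row_set (L *m M')).
Proof.
move=> eqM /inverse_closedP SN; apply/inverse_closedP => _ [i _ <-].
have [|j _ Ej] := SN (row i (L *m M)); first by exists i.
exists j => //; move: Ej; rewrite !row_mul -!mulNmx.
by case: (equiv_translations_eq (row j L) (- row i L) eqM).
Qed.

(** * Trading scalings between coordinates *)

Definition scale_at (i : 'I_n) (b : nat) : 'M[int]_n :=
  diag_mx (\row_k (if k == i then b%:Z else 1)).

(** On the two coordinates u = x_i and v = x_j this is the bijection of Z^2
    (u, v) |-> (b u + v mod b, v div b): the last digit of v in base b is moved
    to u. *)
Definition carry (b : nat) (i j : 'I_n) (x : 'rV[int]_n) : 'rV[int]_n :=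
  \row_k (if k == i then b%:Z * x 0 i + (x 0%R j %% b)%Z
          else if k == j then (x 0%R j %/ b)%Z else x 0 k).

Lemma carryK b i j : (0 < b)%N -> i != j -> cancel (carry b i j) (carry b j i).
Proof.
move=> b0 ij x; apply/rowP => k; rewrite !mxE !eqxx (eq_sym j) (negPf ij).
have b1 : b%:Z != 0 by lia.
case: (eqVneq k j) => [->|kj].
  rewrite mulrC [b%:Z * _]mulrC modzMDl modz_mod. exact: esym (divz_eq _ _).
case: (eqVneq k i) => [->|//].
rewrite mulrC divzMDl// divz_small ?addr0//; lia.
Qed.

(** Adding b to coordinate j, or 1 to coordinate i, becomes after [carry] adding 1
    to coordinate j, or b to coordinate i. *)
Lemma scale_at_move b i j : (0 < b)%N ->
  equiv_translations (scale_at j b) (scale_at i b).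
Proof.
move=> b0; have b1 : b%:Z != 0 by lia.
have [->|ij] := eqVneq i j.
  by exists id => //; exists id.
exists (carry b i j).
  by exists (carry b j i); apply: carryK => //; rewrite eq_sym.
move=> x t; rewrite /scale_at !mul_mx_diag; apply/rowP => k.
rewrite !mxE eqxx (negPf ij).
case: (eqVneq k i) => [->|ki].
  rewrite mulr1 [in x 0%R j + _]addrC modzMDl; ring.
case: (eqVneq k j) => [->|kj]; rewrite ?mulr1 //.
by rewrite addrC divzMDl // addrC.
Qed.

Lemma scale_at_mul i b c : scale_at i b *m scale_at i c = scale_at i (b * c).
Proof.
apply/matrixP => k l; rewrite mul_diag_mx !mxE.
case: (eqVneq k l) => [->|_]; rewrite ?mulr0n ?mulr0 // !mulr1n.
by case: eqP; rewrite ?mulr1 // PoszM.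
Qed.

(** All index can be concentrated in one coordinate: a diagonal matrix is a
    product of commuting [scale_at]'s, each of which can be placed last and moved
    to coordinate i.  The arbitrary left factor P serves the singular case,
    where P has a zero column i that absorbs the result. *)
Lemma gather_scaling P i (b : 'I_n -> nat) : (forall k, (0 < b k)%N) ->
  equiv_translations (P *m diag_mx (\row_k (b k)%:Z))
                     (P *m scale_at i (\prod_k b k)).
Proof.
move=> b0.
pose D (s : seq 'I_n) := diag_mx (\row_k (if k \in s then (b k)%:Z else 1)).
suff H s : uniq s -> forall Q,
    equiv_translations (Q *m D s) (Q *m scale_at i (\prod_(k <- s) b k)).
  have := H _ (index_enum_uniq 'I_n) P; congr (equiv_translations (_ *m _) _).
  by congr diag_mx; apply/rowP => k; rewrite !mxE mem_index_enum.
elim: s => [|j s IH] /=.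
  move=> _ Q; rewrite big_nil (_ : D _ = scale_at i 1); last first.
    by congr diag_mx; apply/rowP => k; rewrite !mxE; case: eqP.
  by exists id => //; exists id.
move=> /andP[js us] Q; have -> : D (j :: s) = D s *m scale_at j (b j).
  apply/matrixP => k l; rewrite mul_diag_mx !mxE.
  case: (eqVneq k l) => [->|_]; rewrite ?mulr0n ?mulr0 // !mulr1n in_cons.
  by case: eqP => [->|] /=; rewrite ?(negPf js) ?mul1r ?mulr1.
have e1 : D s *m scale_at i (b j) = scale_at i (b j) *m D s by exact: diag_mxC.
rewrite big_cons -scale_at_mul.
apply: (@equiv_translations_trans _ (Q *m (D s *m scale_at i (b j)))).
  by rewrite !mulmxA; apply: equiv_translations_mull; apply: scale_at_move.
by rewrite e1 !mulmxA; apply: IH.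
Qed.
End EquivTranslations.

(** * Counting components *)

Section Components.
Variables (n N : nat) (L : 'M[int]_(N, n)) (P : 'M[int]_(n, N)).
Hypothesis PL : P *m L = 1%:M.

Lemma Cay_connected (M : 'M[int]_n) (x t : 'rV_n) :
  clos_refl_sym_trans _ (Cay (row_set (L *m M))) x (x + t *m M).
Proof.
set conn := clos_refl_sym_trans _ _.
pose Q h := forall x, conn x (x + h).
have Q0 : Q 0 by move=> z; rewrite addr0; exact: rst_refl.
have QD u v : Q u -> Q v -> Q (u + v).
  by move=> Qu Qv z; rewrite addrA; apply: rst_trans (Qu z) (Qv _).
have QN u : Q u -> Q (- u).
  by move=> Qu z; apply: rst_sym; rewrite -{2}[z](subrK u); exact: Qu.
have Qrow i : Q (row i (L *m M)).
  by move=> z; apply: rst_step; exists (row i (L *m M)) => //; exists i.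
have Qn u k : Q u -> Q (u *+ k).
  by move=> Qu; elim: k => [//|k IH]; rewrite mulrS; exact: QD.
have QZ i (c : int) : Q (c *: row i (L *m M)).
  rewrite -[c]intz scaler_int; case: c => k; first exact: Qn.
  by apply: QN; exact: Qn.
suff : Q (t *m M) by apply.
have -> : t *m M = (t *m P) *m (L *m M) by rewrite -mulmxA (mulmxA P) PL mul1mx.
by rewrite mulmx_sum_row; apply: (big_ind Q) => // i _; exact: QZ.
Qed.

(** Modulo the translations by scale_at i m, every vector is a multiple r < m of
    the i-th basis vector; pulling these m representatives back along the
    equivalence gives one in every component. *)
Lemma components_le (M : 'M[int]_n) (i : 'I_n) (m : nat) : (0 < m)%N ->
  equiv_translations M (scale_at i m) ->
  components (Cay (row_set (L *m M))) #<= `I_m.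
Proof.
move=> m0 [f [g fK gK] fE].
pose c x := [set y | clos_refl_sym_trans _ (Cay (row_set (L *m M))) x y].
apply: card_le_trans (card_image_le
  (fun r : nat => c (g (r%:Z *: delta_mx 0 i))) `I_m).
apply: subset_card_le => _ [x _ <-]; set y := f x.
exists `|y 0%R i %% m|%Z%N; first by rewrite /=; lia.
set z := g _.
pose t : 'rV[int]_n := \row_k (if k == i then (y 0%R k %/ m)%Z else y 0 k).
have -> : x = z + t *m M.
  apply: (can_inj fK); rewrite fE gK -/y; apply/rowP => k.
  rewrite /scale_at mul_mx_diag !mxE eqxx /=.
  case: eqVneq => [->|_]; last by rewrite mulr0 add0r mulr1.
  rewrite mulr1 gez0_abs; last by rewrite modz_ge0; lia.
  by rewrite addrC; exact: divz_eq.
have C := Cay_connected M z t.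
apply/seteqP; split=> w /= H; last exact: rst_trans C H.
exact: rst_trans (rst_sym _ _ _ _ C) H.
Qed.
End Components.

(** * Generators in Smith normal form *)

(** P *m L = 1 says that the rows of L generate Z^n.  The matrix of generators is
    padded with copies of one of them, so that it has at least n rows and its
    Smith form splits off a square diagonal block; L is then formed by the first
    n columns of an invertible matrix. *)
Lemma generators_Smith n (S : set 'rV[int]_n) : finite_set S -> S !=set0 ->
  exists N (L : 'M_(N, n)) (P : 'M_(n, N)) (d : 'rV_n) (R : 'M_n),
    [/\ P *m L = 1%:M, R \in unitmx & S = row_set (L *m (diag_mx d *m R))].
Proof.
move=> /finite_seqP[s ->] [s0 /= s0s].
pose q := size s; pose M : 'M[int]_(n + q, n) := \matrix_i nth s0 s i.
have [U uU [R uR [d _ ME]]] := int_Smith_normal_form M.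
pose D : 'rV[int]_n := \row_k d`_k.
exists (n + q)%N, (lsubmx U), (usubmx (invmx U)), D, R; split=> //.
  have := mulVmx uU; set V := invmx U.
  rewrite -{1}[V]vsubmxK -{1}[U]hsubmxK mul_col_row.
  by rewrite scalar_mx_block => /eq_block_mx[].
have -> : lsubmx U *m (diag_mx D *m R) = M.
  rewrite mulmxA ME; congr (_ *m R).
  rewrite -{2}[U]hsubmxK (_ : \matrix_(i, j) _ = col_mx (diag_mx D) 0).
    by rewrite mul_row_col mulmx0 addr0.
  apply/matrixP => i j; rewrite !mxE.
  case: splitP => k ik; rewrite !mxE ik //.
  case: eqP => // E; have := ltn_ord j; lia.
apply/seteqP; split=> x /=.
  move=> xs; have xq : (n + index x s < n + q)%N by rewrite ltn_add2l index_mem.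
  have xq' : (index x s < n + q)%N by rewrite (leq_trans _ xq) // ltnS leq_addl.
  by exists (Ordinal xq') => //; rewrite rowK nth_index.
move=> [i _ <-]; rewrite rowK.
have [/(mem_nth s0)//|/(nth_default s0)->//] := ltnP i (size s).
Qed.

(** * Infinite index: S and 2S *)

(** If an automorphism a maps S onto 2S and all of S is divisible by 2 ^ k, then
    a S is divisible by 2 ^ k.+1, hence so is S.  So the elements of S are
    infinitely divisible, which in Z^n only 0 is. *)
Lemma not_aut_equivalent_double n (S : set 'rV[int]_n) :
  connection_set S -> S !=set0 -> ~ aut_equivalent S ((fun x => x *+ 2) @` S).
Proof.
move=> S0 [s Ss] [a [b aK bK] aS].
have H k : forall x, S x -> exists y, x = y *+ 2 ^ k.
  elim: k => [|k IH] x Sx; first by exists x.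
  have [z Sz E] : ((fun x => x *+ 2) @` S) (a x) by rewrite -aS; exists x.
  have [y zE] := IH _ Sz; exists (b y); apply: (can_inj aK).
  by rewrite raddfMn /= bK -E zE -mulrnA expnSr.
apply: S0; suff -> : 0 = s by [].
apply/esym/rowP => i; rewrite mxE.
have [k kE] : exists k, `|s 0%R i|%N = k by exists `|s 0%R i|%N.
have [y E] := H k _ Ss; have := ltn_expl k (isT : (1 < 2)%N).
move: kE; rewrite E mulmxnE -mulr_natr; set c := y 0 i.
have [-> _ _|c0] := eqVneq c 0; first by rewrite mul0r.
rewrite abszM natz absz_nat; nia.
Qed.

(** * Matrices permuting a finite generating set *)

Section Rigidity.
Variables (n N : nat) (L : 'M[int]_(N, n)) (P : 'M[int]_(n, N)).
Hypothesis PL : P *m L = 1%:M.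

(** Minkowski's lemma for the matrices that map rows of L to rows of L.  The
    norm of a column x is the largest absolute value of an entry of L *m x, and
    g = 1 + 3C does not increase it.  Since 3Cx = gx - x has norm at most twice
    that of x, the vector Cx is shorter than x (or x = 0), so by induction on
    the norm C(Cx) = 0.  Then the k-th power of g maps x to x + 3k Cx; none of
    these vectors is longer than x, which forces Cx = 0. *)
Lemma congruent1_permuting_eq1 (C : 'M_n) (p : 'I_N -> 'I_N) :
  L *m (1%:M + C *+ 3) = rowsub p L -> C = 0.
Proof.
set g := _ + _ => Lg.
pose bnd c (x : 'cV[int]_n) := forall i, (`|(L *m x) i 0%R| <= c)%N.
have gx (x : 'cV_n) : g *m x = x + (C *m x) *+ 3.
  by rewrite /g mulmxDl mul1mx -[C *+ 3]scaler_nat -scalemxAl scaler_nat.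
have bndg c x : bnd c x -> bnd c (g *m x).
  by move=> bx i; rewrite mulmxA Lg mul_rowsub_mx mxE.
have L0 (x : 'cV_n) : (forall i, (L *m x) i 0 = 0) -> x = 0.
  move=> Lx0; rewrite -[x]mul1mx -PL -mulmxA (_ : L *m x = 0) ?mulmx0 //.
  by apply/colP => i; rewrite Lx0 mxE.
have key c : forall x, bnd c x -> C *m x = 0.
  elim/ltn_ind: c => c IH x bx.
  have entry k i : (L *m (x + (C *m x) *+ k)) i 0
      = (L *m x) i 0 + (L *m (C *m x)) i 0 * k%:Z.
    by rewrite mulmxDr -!scaler_nat -scalemxAr !mxE natz mulrC.
  have CCx : C *m (C *m x) = 0.
    case: c IH bx => [_ bx|c IH bx].
      rewrite (L0 x) ?mulmx0 // => i.
      by apply/eqP; rewrite -absz_eq0 -leqn0; exact: bx.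
    apply: (IH c) => // i; have := bndg _ _ bx i; rewrite gx entry.
    have := bx i; lia.
  (* x + 3k Cx is the image of x under the k-th power of g. *)
  have bnd_orbit k : bnd c (x + (C *m x) *+ (3 * k)).
    elim: k => [|k IHk]; first by rewrite muln0 mulr0n addr0.
    have := bndg _ _ IHk; rewrite gx mulmxDr.
    rewrite -[C *m (_ *+ _)]/(mulmx C _) raddfMn /= CCx mul0rn addr0.
    by rewrite -addrA -mulrnDr mulnS addnC.
  apply: L0 => i; have := bnd_orbit c.+1 i; rewrite entry; have := bx i; nia.
have C0 (x : 'cV_n) : C *m x = 0.
  apply: (key (\max_i `|(L *m x) i 0%R|)%N) => i.
  exact: (leq_bigmax (F := fun i => `|(L *m x) i 0%R|%N)).
apply/matrixP => i j; have /colP/(_ i) := C0 (delta_mx j 0).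
by rewrite -colE !mxE.
Qed.

(** The matrix b is M *m A *m B^-1 over the rationals.  It is integral because A
    sends each row of L *m M to some row of L *m B, so that right multiplication
    by b sends each row of L to a row of L, and the rows of L generate Z^n; the
    reverse inclusion makes it invertible over the integers. *)
Lemma integral_transfer (M B A : 'M_n) : A \in unitmx ->
  (forall t u : 'rV_n, t *m B = u *m B -> t = u) ->
  (mulmx^~ A) @` row_set (L *m M) = row_set (L *m B) ->
  exists b : 'M_n, [/\ b \in unitmx, M *m A = b *m B,
    exists p : 'I_N -> 'I_N, L *m b = rowsub p L
    & exists q : 'I_N -> 'I_N, L *m invmx b = rowsub q L].
Proof.
move=> uA injB SE.
have injB' (X Y : 'M_(N, n)) : X *m B = Y *m B -> X = Y.
  by move=> E; apply/row_matrixP => i; apply: injB; rewrite -!row_mul E.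
have fwd i : exists j, row j (L *m B) = row i (L *m M *m A).
  have : row_set (L *m B) (row i (L *m M) *m A).
    by rewrite -SE; exists (row i (L *m M)); first by exists i.
  by case=> j _ jE; exists j; rewrite jE -row_mul.
have bwd i : exists j, row j (L *m M *m A) = row i (L *m B).
  have : row_set (L *m B) (row i (L *m B)) by exists i.
  by rewrite -SE => -[_ [j _ <-] <-]; exists j; rewrite !row_mul.
have [p pE] := choice fwd; have [q qE] := choice bwd.
have LMA : L *m M *m A = rowsub p L *m B.
  by apply/row_matrixP => i; rewrite -pE mul_rowsub_mx row_rowsub.
pose b := P *m rowsub p L.
have MA : M *m A = b *m B by rewrite /b -mulmxA -LMA !mulmxA PL mul1mx.
have Lb : L *m b = rowsub p L.
  by apply: injB'; rewrite -LMA -(mulmxA L b) -MA mulmxA.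
have Lq : L = rowsub q L *m b.
  apply: injB'; rewrite -(mulmxA _ b) -MA mul_rowsub_mx mulmxA.
  by apply/row_matrixP => i; rewrite row_rowsub qE.
have ub : b \in unitmx.
  have : (P *m rowsub q L) *m b = 1%:M by rewrite -mulmxA -Lq.
  by case/mulmx1_unit.
exists b; split=> //; first by exists p.
by exists q; rewrite {1}Lq mulmxK.
Qed.

End Rigidity.

Lemma additive_mx n (a : {additive 'rV[int]_n -> 'rV[int]_n}) : bijective a ->
  exists2 A : 'M_n, A \in unitmx & forall x, a x = x *m A.
Proof.
case=> b aK bK; pose A := \matrix_i a (delta_mx 0 i).
have aE x : a x = x *m A.
  rewrite {1}[x]row_sum_delta raddf_sum mulmx_sum_row; apply: eq_bigr => i _.
  by rewrite rowK -[x 0 i]intz !scaler_int raddfMz.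
exists A => //; pose B := \matrix_i b (delta_mx 0 i).
have : B *m A = 1%:M.
  by apply/row_matrixP => i; rewrite row_mul rowK -aE bK row1.
by case/mulmx1_unit.
Qed.

(** * Finite index: a family of pairwise inequivalent matrices *)

Section ShearScale.
Variables (n : nat) (i0 i1 : 'I_n).
Hypothesis i01 : i0 != i1.

(** Row i0 is (m, j) in the coordinates i0, i1, and the other rows are those of
    the identity: a Hermite normal form, whose classes under right
    multiplication by GL_n(Z) are told apart by j modulo m. *)
Definition shear_scale (m j : nat) : 'M[int]_n :=
  scale_at i0 m + j%:Z *: delta_mx i0 i1.

Lemma mul_shear_scale p (t : 'M_(p, n)) m j :
  t *m shear_scale m j =
    t *m scale_at i0 m + j%:Z *: (col i0 t *m delta_mx 0 i1).
Proof.
by rewrite mulmxDr -scalemxAr colE -mulmxA mul_delta_mx.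
Qed.

(** The shear adds j to coordinate i1 each time coordinate i0 passes a multiple
    of m, and leaves coordinate i0 alone, so it is undone by the shear for -j. *)
Lemma shear_scale_equiv m j : (0 < m)%N ->
  equiv_translations (scale_at i0 m) (shear_scale m j).
Proof.
move=> m0; have m1 : m%:Z != 0 by lia.
pose f (c : int) (x : 'rV[int]_n) : 'rV[int]_n :=
  x + (c * (x 0%R i0 %/ m)%Z) *: delta_mx 0 i1.
have fi0 c x : f c x 0 i0 = x 0 i0.
  by rewrite !mxE (negPf i01) mulr0 addr0.
have fK c : cancel (f c) (f (- c)).
  by move=> x; rewrite {1}/f fi0 /f -addrA -scalerDl mulNr addrN scale0r addr0.
exists (f j).
  by exists (f (- j%:Z)); [exact: fK|rewrite -{2}[j%:Z]opprK; exact: fK].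
move=> x t; rewrite mul_shear_scale /f.
have -> : divz ((x + t *m scale_at i0 m) 0 i0) m = (x 0%R i0 %/ m)%Z + t 0 i0.
  by rewrite /scale_at mul_mx_diag !mxE eqxx addrC divzMDl // addrC.
rewrite mulrDr scalerDl -!addrA; congr (_ + _); rewrite addrCA; congr (_ + _).
congr (_ + _); rewrite -scalerA; congr (_ *: _).
apply/rowP => k; rewrite !mxE big_ord1 !mxE //.
Qed.

Lemma shear_scale_inj m j (t u : 'rV_n) : (0 < m)%N ->
  t *m shear_scale m j = u *m shear_scale m j -> t = u.
Proof.
move=> m0; have m1 : m%:Z != 0 by lia.
move=> /(equiv_translations_eq _ _ (shear_scale_equiv j m0)).
rewrite /scale_at !mul_mx_diag => /rowP E; apply/rowP => k.
by have := E k; rewrite !mxE; case: eqP => _; [exact: mulIf|rewrite !mulr1].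
Qed.

Lemma shear_scale_index_inj m j k (U : 'M_n) : (j < m)%N -> (k < m)%N ->
  shear_scale m j *m U = shear_scale m k -> j = k.
Proof.
move=> jm km /matrixP E.
have entry i : (shear_scale m j *m U) i i1
    = (if i == i0 then m%:Z else 1) * U i i1 + j%:Z * ((i == i0)%:R * U i1 i1).
  rewrite mulmxDl -scalemxAl /scale_at mul_diag_mx.
  rewrite -(mul_delta_mx (0 : 'I_1)) -mulmxA -rowE !mxE big_ord1 !mxE.
  by rewrite eqxx andbT.
have := E i1 i1; have := E i0 i1; rewrite !entry !mxE !eqxx.
rewrite [i1 == i0]eq_sym (negPf i01) /=.
rewrite !mul1r !mulr0 !mul0r !mulr0n !mulr0 !addr0 => H1 H2.
move: H1; rewrite H2; move: (U i0 i1) => u; clear -jm km => E.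
have [u_neg|[u0|u_pos]] : u <= -1 \/ u = 0 \/ 1 <= u by lia.
- by nia.
- by move: E; rewrite u0; lia.
- by nia.
Qed.

(** The pigeonhole argument: with more than 3 ^ (n * n) matrices B_j, two of the
    transfer matrices b_j, b_k agree modulo 3.  As b_j *m b_k^-1 permutes the rows
    of L, they are equal, and B_j and B_k then differ by an automorphism. *)
Lemma inequivalent_of_index N (L : 'M_(N, n)) (P : 'M_(n, N)) (M : 'M_n) m :
  P *m L = 1%:M -> (3 ^ (n * n) < m)%N ->
  equiv_translations M (scale_at i0 m) ->
  exists2 M', equiv_translations M M'
    & ~ aut_equivalent (row_set (L *m M)) (row_set (L *m M')).
Proof.
move=> PL m_big eqM; apply: contrapT => noM'.
have m0 : (0 < m)%N by apply: leq_ltn_trans m_big.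
have ex (j : 'I_m) : exists b : 'M_n, [/\ b \in unitmx,
    exists2 A : 'M_n, A \in unitmx & M *m A = b *m shear_scale m j,
    exists p : 'I_N -> 'I_N, L *m b = rowsub p L
    & exists q : 'I_N -> 'I_N, L *m invmx b = rowsub q L].
  have : aut_equivalent (row_set (L *m M)) (row_set (L *m shear_scale m j)).
    apply: contrapT => H; apply: noM'; exists (shear_scale m j) => //.
    exact: equiv_translations_trans eqM (shear_scale_equiv j m0).
  case=> a /additive_mx[A uA aE] aS.
  have [||b [ub MA Hp Hq]] :=
    integral_transfer PL uA (B := shear_scale m j) (M := M).
  - by move=> t u; exact: shear_scale_inj.
  - by rewrite -aS; apply: eq_imagel => x _; rewrite aE.
  by exists b; split=> //; exists A.
have [b bE] := choice ex.
pose h (j : 'I_m) : 'M['I_3]_n :=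
  map_mx (fun x : int => inord `|x %% 3|%Z%N) (b j).
have /injectivePn[j [k jk hE]] : ~~ injectiveb h.
  apply/negP => /injectiveP/leq_card; rewrite card_mx !card_ord leqNgt.
  by rewrite m_big.
have [ubj [A uA EA] [p pE] _] := bE j.
have [ubk [A' uA' EA'] _ [q qE]] := bE k.
pose C := map_mx (divz^~ 3) (b j) - map_mx (divz^~ 3) (b k).
have bjk : b j = b k + C *+ 3.
  apply/matrixP => r s; have /matrixP/(_ r s) := hE.
  rewrite !mxE => /(congr1 val) /=; rewrite !inordK; lia.
have C0 : C *m invmx (b k) = 0.
  apply: (congruent1_permuting_eq1 PL (p := q \o p)).
  have <- : b j *m invmx (b k) = 1%:M + (C *m invmx (b k)) *+ 3.
    by rewrite bjk mulmxDl mulmxV // -!scaler_nat scalemxAl.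
  by rewrite mulmxA pE mul_rowsub_mx qE rowsub_comp.
have bb : b j = b k.
  by rewrite bjk -[C](mulmxKV ubk) C0 mul0mx mul0rn addr0.
have sjk : shear_scale m j *m (invmx A *m A') = shear_scale m k.
  rewrite -[shear_scale m j](mulKmx ubj) -EA -mulmxA (mulmxA (M *m A)).
  by rewrite mulmxK // EA' -bb mulKmx.
move/eqP: jk; apply; apply: val_inj.
exact: shear_scale_index_inj (ltn_ord j) (ltn_ord k) sjk.
Qed.
End ShearScale.

(** * Diagonal matrices *)

(** The n factors 2 gathered at coordinate i multiply the zero entry there. *)
Lemma diag_equiv_singular n (d : 'rV[int]_n) (i : 'I_n) : d 0 i = 0 ->
  equiv_translations (diag_mx d) (diag_mx d *+ 2).
Proof.
move=> d0; apply: equiv_translations_sym.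
have := gather_scaling (diag_mx d) i (b := fun=> 2%N) (fun=> isT).
congr (equiv_translations _ _).
  apply/matrixP => k l; rewrite mul_diag_mx mulmxnE !mxE.
  case: (k == l); rewrite ?mulr0n ?mulr0 ?mul0rn // !mulr1n.
  by rewrite -mulr_natr.
apply/matrixP => k l; rewrite mul_diag_mx !mxE.
have [->|] := eqVneq k l; rewrite ?mulr0n ?mulr0 // !mulr1n.
by case: eqP => [->|_]; rewrite ?d0 ?mul0r ?mulr1.
Qed.

Lemma diag_equiv_regular n (d : 'rV[int]_n) (i : 'I_n) :
  (forall k, d 0 k != 0) ->
  equiv_translations (diag_mx d) (scale_at i (\prod_k `|d 0%R k|%N)).
Proof.
move=> d0; pose s : 'M[int]_n := diag_mx (\row_k sgz (d 0 k)).
have us : s \in unitmx.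
  have : s *m s = 1%:M.
    apply/matrixP => k l; rewrite mul_diag_mx !mxE.
    have [->|] := eqVneq k l; rewrite ?mulr0n ?mulr0 // !mulr1n.
    by have := d0 l; lia.
  by case/mulmx1_unit.
have := @gather_scaling n 1%:M i (fun k => `|d 0%R k|%N); rewrite !mul1mx => H.
apply: equiv_translations_trans (H _); last by move=> k; rewrite absz_gt0.
apply: equiv_translations_sym.
rewrite (_ : diag_mx d = diag_mx (\row_k `|d 0%R k|%N%:Z) *m s).
  exact: equiv_translations_mulr.
apply/matrixP => k l; rewrite mul_diag_mx !mxE.
have [->|] := eqVneq k l; rewrite ?mulr0n ?mulr0 // !mulr1n.
by rewrite mulrC -intEsg.
Qed.

(** * Isomorphic Cayley digraphs with inequivalent connection sets *)

(** One set S' serves for digraphs and for graphs, as it is inverse-closed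
    when S is. *)
Lemma exists_inequivalent n (i0 i1 : 'I_n) (S : set 'rV[int]_n) : i0 != i1 ->
  connection_set S -> finite_set S -> S !=set0 ->
  `I_(3 ^ (n * n)).+1 #<= components (Cay S) ->
  exists S', [/\ connection_set S', inverse_closed S -> inverse_closed S',
    digraph_iso (Cay S) (Cay S') & ~ aut_equivalent S S'].
Proof.
move=> i01 S0 finS neS comps.
have [N [L [P [d [R [PL uR SE]]]]]] := generators_Smith finS neS.
set M := diag_mx d *m R in SE.
have dM : equiv_translations (diag_mx d) M by exact: equiv_translations_mulr.
suff [M' eqM H] : exists2 M', equiv_translations M M'
    & ~ aut_equivalent S (row_set (L *m M')).
  exists (row_set (L *m M')); split=> //; rewrite SE in S0 *.
  - exact: connection_set_equiv eqM S0.
  - exact: inverse_closed_equiv.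
  - exact: Cay_equiv_translations.
have [/existsP[i /eqP di]|/existsPn d0] := boolP [exists i, d 0 i == 0].
  exists (M *+ 2).
    apply: equiv_translations_trans (equiv_translations_sym dM) _.
    apply: equiv_translations_trans (diag_equiv_singular di) _.
    by rewrite /M -!scaler_nat scalemxAl; exact: equiv_translations_mulr.
  have -> : row_set (L *m (M *+ 2)) = (fun x => x *+ 2) @` S.
    rewrite SE -scaler_nat -scalemxAr scaler_nat.
    apply/seteqP; split=> [_ [k _ <-]|_ [_ [k _ <-] <-]].
      by exists (row k (L *m M)); [exists k|rewrite raddfMn].
    by exists k; rewrite ?raddfMn.
  exact: not_aut_equivalent_double.
have eqM : equiv_translations M (scale_at i0 (\prod_k `|d 0%R k|%N)).
  apply: equiv_translations_trans (equiv_translations_sym dM) _.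
  exact: diag_equiv_regular.
rewrite {1}SE; apply: (inequivalent_of_index i01 PL _ eqM).
rewrite -card_le_II; apply: card_le_trans comps _; rewrite SE.
apply: (components_le PL _ eqM); rewrite prodn_gt0 // => k.
by rewrite absz_gt0.
Qed.

Theorem corollary6p6 (n : nat) (hn : (1 < n)%N) :
  exists k : nat,
    (forall S : set 'rV[int]_n,
       connection_set S -> finite_set S -> S !=set0 ->
       `I_k #<= components (Cay S) -> ~ DCI_graph S) /\
    (forall S : set 'rV[int]_n,
       connection_set S -> inverse_closed S -> finite_set S -> S !=set0 ->
       `I_k #<= components (Cay S) -> ~ CI_graph S).
Proof.
have i01 : Ordinal (ltnW hn) != Ordinal hn by [].
exists (3 ^ (n * n)).+1; split=> S S0.
  move=> finS neS comps.
  have [S' [S'0 _ iso neq]] := exists_inequivalent i01 S0 finS neS comps.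
  by move/(_ S' S'0 iso).
move=> invS finS neS comps.
have [S' [S'0 invS' iso neq]] := exists_inequivalent i01 S0 finS neS comps.
by move/(_ S' S'0 (invS' invS) iso).
Qed.
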